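(* Let $\mathcal{M}$ be a unitary magma and $k\ge0$ be an integer. Then the space $\mathsf{Cro}_k\mathcal{M}$ is both a quotient operad and a suboperad of $\mathsf{C}\mathcal{M}$. That is, the linear span of all $\mathcal{M}$-cliques $\mathfrak{p}$ with $\mathrm{cros}(\mathfrak{p})\ge k+1$ is an operad ideal of $\mathsf{C}\mathcal{M}$ (the quotient by which is $\mathsf{Cro}_k\mathcal{M}$), and the linear span of all $\mathcal{M}$-cliques $\mathfrak{p}$ with $\mathrm{cros}(\mathfrak{p})\le k$ is a suboperad of $\mathsf{C}\mathcal{M}$.
   Context: All vector spaces are over a field $\mathbb{K}$ of characteristic zero; $[n]=\{1,\dots,n\}$. Operad means nonsymmetric operad in vector spaces, graded by arities $n\ge1$, with partial compositions $\circ_i$ and a unit in arity $1$. An operad ideal $I$ of $\mathcal{O}$ is a graded subspace such that for all $x\in\mathcal{O}$, $y\in I$, all $x\circ_iy$ and $y\circ_jx$ lie in $I$. A unitary magma is a set $\mathcal{M}$ with a binary operation $\star$ (not necessarily associative) having a two-sided unit $\mathds{1}_{\mathcal{M}}$. An $\mathcal{M}$-clique $\mathfrak{p}$ of arity $n\ge1$ is a map assigning to every arc $(x,y)$, $1\le x<y\le n+1$, a label $\mathfrak{p}(x,y)\in\mathcal{M}$; by convention, the only $\mathcal{M}$-clique of arity $1$ is the one with $\mathfrak{p}(1,2)=\mathds{1}_{\mathcal{M}}$. Put $\mathfrak{p}_0:=\mathfrak{p}(1,n+1)$ and $\mathfrak{p}_i:=\mathfrak{p}(i,i+1)$ for $i\in[n]$.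 $\mathsf{C}\mathcal{M}$ is the operad whose space $\mathsf{C}\mathcal{M}(n)$ is the linear span of all $\mathcal{M}$-cliques of arity $n$, whose unit is the unique $\mathcal{M}$-clique of arity $1$, and where, for $\mathcal{M}$-cliques $\mathfrak{p},\mathfrak{q}$ of arities $n,m$ and $i\in[n]$, $\mathfrak{p}\circ_i\mathfrak{q}$ is the $\mathcal{M}$-clique of arity $n+m-1$ with $$(\mathfrak{p}\circ_i\mathfrak{q})(x,y)=\begin{cases}\mathfrak{p}(x,y)&\text{if }y\le i,\\ \mathfrak{p}(x,y-m+1)&\text{if }x\le i<i+m\le y,\ (x,y)\ne(i,i+m),\\ \mathfrak{p}(x-m+1,y-m+1)&\text{if }i+m\le x,\\ \mathfrak{q}(x-i+1,y-i+1)&\text{if }i\le x<y\le i+m,\ (x,y)\ne(i,i+m),\\ \mathfrak{p}_i\star\mathfrak{q}_0&\text{if }(x,y)=(i,i+m),\\ \mathds{1}_{\mathcal{M}}&\text{otherwise.}\end{cases}$$ A diagonal of an $\mathcal{M}$-clique of arity $n$ is an arc different from $(1,n+1)$ and from all $(x,x+1)$. An arc is solid if its label is not $\mathds{1}_{\mathcal{M}}$. Two diagonals $(x,y)$ and $(x',y')$ are crossing if $x<x'<y<y'$ or $x'<x<y'<y$. The crossing of a solid diagonal is the number of solid diagonals crossing it, and $\mathrm{cros}(\mathfrak{p})$ is the maximal crossing among the solid diagonals of $\mathfrak{p}$ ($0$ if there are none). As a quotient of graded vector spaces, $\mathsf{Cro}_k\mathcal{M}$ is $\mathsf{C}\mathcal{M}$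 modulo the span of all $\mathfrak{p}$ with $\mathrm{cros}(\mathfrak{p})\ge k+1$; it is identified with the span of all $\mathfrak{p}$ with $\mathrm{cros}(\mathfrak{p})\le k$. *)

(* Defs.v *)
From HB Require Import structures.
From mathcomp Require Import all_boot all_order all_algebra.
From mathcomp Require Import finmap zify monalg.

Set Implicit Arguments.
Unset Strict Implicit.
Unset Printing Implicit Defensive.

Import GRing.Theory.

(* The space of arity 0 is required to be zero, so that the nontrivial arities
   are n >= 1. Inputs are numbered from 0, so o_i for i in {1, ..., n} is given
   by the ordinal i - 1 in 'I_n.
   The two sides of the associativity axioms live in spaces whose arities are
   only propositionally equal, hence the comparison of tagged elements. *)
Record operad (K : fieldType) := Operad {
  op_space :> nat -> lmodType K;
  op_one : op_space 1;
  op_comp : forall n m,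
    'I_n -> op_space n -> op_space m -> op_space (n + m).-1;
  op_space0 : forall x : op_space 0, x = 0%R;
  op_comp_linearl : forall n m (i : 'I_n) (y : op_space m),
    linear (fun x : op_space n => op_comp i x y);
  op_comp_linearr : forall n m (i : 'I_n) (x : op_space n),
    linear (fun y : op_space m => op_comp i x y);
  op_comp1l : forall n (i : 'I_1) (x : op_space n),
    Tagged op_space (op_comp i op_one x) = Tagged op_space x;
  op_comp1r : forall n (i : 'I_n) (x : op_space n),
    Tagged op_space (op_comp i x op_one) = Tagged op_space x;
  op_comp_seq : forall n m l (i : 'I_n) (j : 'I_m) (k : 'I_(n + m).-1)
      (x : op_space n) (y : op_space m) (z : op_space l),
    k = i + j :> nat ->
    Tagged op_space (op_comp k (op_comp i x y) z)
      = Tagged op_space (op_comp i x (op_comp j y z));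
  op_comp_par : forall n m l (i j : 'I_n)
      (j' : 'I_(n + m).-1) (i' : 'I_(n + l).-1)
      (x : op_space n) (y : op_space m) (z : op_space l),
    i < j -> j' = (j + m).-1 :> nat -> i' = i :> nat ->
    Tagged op_space (op_comp j' (op_comp i x y) z)
      = Tagged op_space (op_comp i' (op_comp j x z) y)
}.

Section LinearNotions.
Variable K : fieldType.
Local Open Scope ring_scope.

Definition subspace (V : lmodType K) (S : V -> Prop) : Prop :=
  S 0 /\ forall (a : K) (u v : V), S u -> S v -> S (a *: u + v).

Definition span (V : lmodType K) (S : V -> Prop) (v : V) : Prop :=
  exists s : seq (K * V),
    (forall c, c \in s -> S c.2) /\ v = \sum_(c <- s) c.1 *: c.2.

Definition operad_ideal (O : operad K) (I : forall n, O n -> Prop) : Prop :=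
  (forall n, subspace (@I n)) /\
  (forall n m (x : O n) (y : O m), I m y ->
     (forall i : 'I_n, I _ (op_comp i x y)) /\
     (forall j : 'I_m, I _ (op_comp j y x))).

Definition suboperad (O : operad K) (S : forall n, O n -> Prop) : Prop :=
  [/\ forall n, subspace (@S n),
      S 1%N (op_one O) &
      forall n m (i : 'I_n) (x : O n) (y : O m),
        S n x -> S m y -> S _ (op_comp i x y)].

End LinearNotions.

(* Vertices are numbered from 0 to n instead of from 1 to n + 1. *)
Definition arc n := {xy : 'I_n.+1 * 'I_n.+1 | xy.1 < xy.2}.
Definition src n (a : arc n) : nat := (val a).1.
Definition tgt n (a : arc n) : nat := (val a).2.

Section Cliques.
Variable M : umagmaType.
Local Open Scope group_scope.

(* There is no clique of arity 0, and the only one of arity 1 has label 1. *)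
Definition clique_axiom n (p : {ffun arc n -> M}) : bool :=
  (0 < n)%N && ((n == 1%N) ==> [forall a, p a == 1]).

Definition clique n := {p : {ffun arc n -> M} | clique_axiom p}.

(* The value 1 when (x, y) is not an arc is a dummy one. *)
Definition label n (p : clique n) (x y : nat) : M :=
  if [pick a : arc n | (src a == x) && (tgt a == y)] is Some a
  then val p a else 1.

(* Compared with numbering vertices and inputs from 1, only the arcs of q change
   form: (x - i + 1, y - i + 1) becomes (x - i, y - i) and (1, m + 1) becomes
   (0, m). *)
Definition comp_label n m (p : clique n) (i : nat) (q : clique m)
    (x y : nat) : M :=
  if y <= i then label p x y
  else if [&& x <= i, i + m <= y & (x, y) != (i, i + m)%N]
    then label p x (y - m + 1)
  else if i + m <= x then label p (x - m + 1) (y - m + 1)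
  else if [&& i <= x, y <= i + m & (x, y) != (i, i + m)%N]
    then label q (x - i) (y - i)
  else if (x, y) == (i, i + m)%N then label p i i.+1 * label q 0 m
  else 1.

Lemma labelE n (p : clique n) (a : arc n) : label p (src a) (tgt a) = val p a.
Proof.
rewrite /label; case: pickP => [b /andP[/eqP eqs /eqP eqt]|/(_ a)]; last first.
  by rewrite !eqxx.
congr (val p _); apply: val_inj; move: eqs eqt; rewrite /src /tgt.
by case: (val a) (val b) => [a1 a2] [b1 b2] /= eq1 eq2; congr pair; apply: val_inj.
Qed.

Lemma label_out n (p : clique n) x y : ~~ ((x < y) && (y <= n)) -> label p x y = 1.
Proof.
rewrite /label; case: pickP => //= a /andP[/eqP <- /eqP <-].
by rewrite /src /tgt (valP a) -ltnS ltn_ord.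
Qed.

Lemma label1 n (p : clique n) x y : n = 1%N -> label p x y = 1.
Proof.
move=> n1; rewrite /label; case: pickP => //= a _.
by case/andP: (valP p) => _ /implyP /(_ (introT eqP n1)) /forallP /(_ a) /eqP.
Qed.

Lemma comp_clique_axiom n m (p : clique n) (i : 'I_n) (q : clique m) :
  clique_axiom [ffun a : arc (n + m).-1 => comp_label p i q (src a) (tgt a)].
Proof.
have /andP[n_gt0 _] := valP p; have /andP[m_gt0 _] := valP q.
apply/andP; split; first by lia.
apply/implyP => /eqP nm1; apply/forallP => a; rewrite ffunE /comp_label.
have [n1 m1] : n = 1%N /\ m = 1%N by lia.
by rewrite !(label1 p) // !(label1 q) // mulg1; do !case: ifP.
Qed.

Definition comp_clique n m (p : clique n) (i : 'I_n) (q : clique m)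
  : clique (n + m).-1 := exist (@clique_axiom _) _ (comp_clique_axiom p i q).

Lemma unit_clique_axiom : clique_axiom [ffun=> 1 : M] (n := 1).
Proof. by apply/andP; split=> //=; apply/forallP => a; rewrite ffunE. Qed.

Definition unit_clique : clique 1 := exist (@clique_axiom 1) _ unit_clique_axiom.

Definition diagonal n (a : arc n) : bool :=
  ((src a, tgt a) != (0, n)%N) && (tgt a != (src a).+1).

Definition solid n (p : clique n) (a : arc n) : bool := val p a != 1.

Definition crossing n (a b : arc n) : bool :=
  [&& src a < src b, src b < tgt a & tgt a < tgt b]
  || [&& src b < src a, src a < tgt b & tgt b < tgt a].

Definition crossing_number n (p : clique n) (a : arc n) : nat :=
  #|[set b : arc n | [&& diagonal b, solid p b & crossing a b]]|.

Definition cros n (p : clique n) : nat :=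
  \max_(a : arc n | diagonal a && solid p a) crossing_number p a.

Lemma label_comp n m (p : clique n) (i : 'I_n) (q : clique m) x y :
  label (comp_clique p i q) x y =
    if (x < y) && (y <= (n + m).-1) then comp_label p i q x y else 1.
Proof.
case: ifPn => [/andP[ltxy leyN]|]; last exact: label_out.
have ltyN : y < (n + m).-1.+1 by [].
have ltxN : x < (n + m).-1.+1 by exact: ltn_trans ltyN.
pose a : arc (n + m).-1 :=
  exist (fun xy : 'I_(_.+1) * 'I_(_.+1) => xy.1 < xy.2) (Ordinal ltxN, Ordinal ltyN) ltxy.
by have := labelE (comp_clique p i q) a; rewrite ffunE.
Qed.

Lemma label_inj n (p q : clique n) :
  (forall x y, x < y -> y <= n -> label p x y = label q x y) -> p = q.
Proof.
move=> eqpq; apply: val_inj; apply/ffunP => a.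
rewrite -!labelE; apply: eqpq; first exact: valP a.
by rewrite -ltnS; exact: ltn_ord.
Qed.

Lemma clique_gt0 n (p : clique n) : 0 < n.
Proof. by case/andP: (valP p). Qed.

End Cliques.

Section LinearExtension.
Variables (K : fieldType) (T : choiceType) (V : lmodType K).
Local Open Scope ring_scope.

Definition linext (f : T -> V) (x : {malg K[T]}) : V :=
  \sum_(t <- msupp x) x@_t *: f t.

Lemma linextEw f (x : {malg K[T]}) (d : {fset T}) : (msupp x `<=` d)%fset ->
  linext f x = \sum_(t <- d) x@_t *: f t.
Proof.
move=> led; rewrite /linext; apply/big_fset_incl => // t _ /mcoeff_outdom ->.
by rewrite scale0r.
Qed.

Lemma linextU f t : linext f << t >> = f t.
Proof. by rewrite /linext msuppU oner_eq0 big_seq_fset1 mcoeffUU scale1r. Qed.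

Lemma linext_linear f : linear (linext f).
Proof.
move=> a x y; pose d := (msupp x `|` msupp y `|` msupp (a *: x + y))%fset.
have lex : (msupp x `<=` d)%fset by rewrite /d -fsetUA fsubsetUl.
have ley : (msupp y `<=` d)%fset by rewrite /d fsetUAC fsubsetUr.
have lexy : (msupp (a *: x + y) `<=` d)%fset by rewrite /d fsubsetUr.
rewrite (linextEw f lex) (linextEw f ley) (linextEw f lexy).
rewrite scaler_sumr -big_split; apply: eq_bigr => t _ /=.
by rewrite mcoeffD mcoeffZ scalerDl scalerA.
Qed.

Lemma linext_linearf (x : {malg K[T]}) a (f g : T -> V) :
  linext (fun t => a *: f t + g t) x = a *: linext f x + linext g x.
Proof.
rewrite /linext scaler_sumr -big_split; apply: eq_bigr => t _ /=.
by rewrite scalerDr !scalerA (mulrC a).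
Qed.

Lemma linear_eq (f g : {malg K[T]} -> V) : linear f -> linear g ->
  (forall t, f << t >> = g << t >>) -> f =1 g.
Proof.
move=> linf ling eqfg x; rewrite (monalgE x).
have lin_sum h : linear h -> h (\sum_(t <- msupp x) << x@_t *g t >>)
    = \sum_(t <- msupp x) x@_t *: h << t >> :> V.
  move=> linh; pose hl := GRing.isLinear.Build K {malg K[T]} V *:%R h linh.
  pose hL : {linear {malg K[T]} -> V} := HB.pack h hl.
  apply: etrans (raddf_sum hL _ _ _) _; apply: eq_bigr => t _ /=.
  rewrite -[RHS](linearZ_LR hL); congr (h _); apply/malgP => u.
  by rewrite mcoeffZ !mcoeffU mulrnAr mulr1.
by rewrite !lin_sum //; apply: eq_bigr => t _; rewrite eqfg.
Qed.

End LinearExtension.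

Section CliqueComposition.
Variable M : umagmaType.

Ltac split_atom b :=
  match b with
  | context [?u <= ?v] =>
      case: (leqP u v) => ? /=; try (exfalso; lia)
  | context [@eq_op _ ?u ?v] =>
      case: (@eqP nat u v) => ? /=; try (exfalso; lia)
  end.

Ltac split_ifs :=
  repeat match goal with
  | |- context [if ?b then _ else _] => split_atom b
  end.

Lemma label_comp1l n (i : 'I_1) (p : clique M n) x y :
  label (comp_clique (unit_clique M) i p) x y = label p x y.
Proof.
have gtn := clique_gt0 p; rewrite label_comp /comp_label.
have -> : i = 0 :> nat by have := ltn_ord i; lia.
rewrite !(label1 (unit_clique M)) // mul1g !subn0 !xpair_eqE.
have out : ~~ ((x < y) && (y <= n)) -> label p x y = 1%g := @label_out _ _ _ _ _.
by split_ifs; first [congr (label p _ _); lia | rewrite out //; lia].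
Qed.

Lemma label_comp1r n (i : 'I_n) (p : clique M n) x y :
  label (comp_clique p i (unit_clique M)) x y = label p x y.
Proof.
have lti := ltn_ord i; rewrite label_comp /comp_label.
rewrite !(label1 (unit_clique M)) // mulg1 !xpair_eqE.
have out : ~~ ((x < y) && (y <= n)) -> label p x y = 1%g := @label_out _ _ _ _ _.
by split_ifs; first [congr (label p _ _); lia | rewrite out //; lia].
Qed.

Lemma label_comp_seq n m l (i : 'I_n) (j : 'I_m) (k : 'I_(n + m).-1)
    (p : clique M n) (q : clique M m) (r : clique M l) x y :
  k = i + j :> nat ->
  label (comp_clique (comp_clique p i q) k r) x y
    = label (comp_clique p i (comp_clique q j r)) x y.
Proof.
move=> eqk; have [[lti ltj] ltk] := (ltn_ord i, ltn_ord j, ltn_ord k).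
have [[gtn gtm] gtl] := (clique_gt0 p, clique_gt0 q, clique_gt0 r).
have q1 u v : m = 1 -> label q u v = 1%g by exact: label1.
rewrite label_comp [RHS]label_comp /comp_label !label_comp /comp_label.
move: (nat_of_ord i) (nat_of_ord j) (nat_of_ord k) (label p) (label q) (label r)
  eqk lti ltj ltk q1 => {}i {}j {}k P Q R -> lti ltj ltk q1.
rewrite !xpair_eqE.
by split_ifs;
  first [ by [] | congr (P _ _); lia | congr (Q _ _); lia | congr (R _ _); lia
        | congr (P _ _ * Q _ _)%g; lia | congr (Q _ _ * R _ _)%g; lia
        | rewrite !q1 ?mulg1 ?mul1g //; lia ].
Qed.

Lemma label_comp_par n m l (i j : 'I_n)
    (j' : 'I_(n + m).-1) (i' : 'I_(n + l).-1)
    (p : clique M n) (q : clique M m) (r : clique M l) x y :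
  i < j -> j' = (j + m).-1 :> nat -> i' = i :> nat ->
  label (comp_clique (comp_clique p i q) j' r) x y
    = label (comp_clique (comp_clique p j r) i' q) x y.
Proof.
move=> ltij eqj eqi; have [lti ltj] := (ltn_ord i, ltn_ord j).
have [[gtn gtm] gtl] := (clique_gt0 p, clique_gt0 q, clique_gt0 r).
rewrite label_comp [RHS]label_comp /comp_label !label_comp /comp_label.
move: (nat_of_ord i) (nat_of_ord j) (nat_of_ord j') (nat_of_ord i')
  (label p) (label q) (label r) ltij eqj eqi lti ltj
  => {}i {}j {}j' {}i' P Q R ltij -> -> lti ltj.
rewrite !xpair_eqE.
by split_ifs;
  first [ by [] | congr (P _ _); lia | congr (Q _ _); lia | congr (R _ _); lia
        | congr (P _ _ * Q _ _)%g; lia | congr (P _ _ * R _ _)%g; lia ].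
Qed.

End CliqueComposition.

Section CliqueOperad.
Variables (K : fieldType) (M : umagmaType).
Local Open Scope ring_scope.

Definition clique_space n : lmodType K := {malg K[clique M n]}.

Definition clique_comp n m (i : 'I_n) (x : clique_space n) (y : clique_space m)
    : clique_space (n + m).-1 :=
  linext (fun p => linext (fun q => << comp_clique p i q >>) y) x.

Lemma clique_compU n m (i : 'I_n) (p : clique M n) (q : clique M m) :
  clique_comp i << p >> << q >> = << comp_clique p i q >>.
Proof. by rewrite /clique_comp !linextU. Qed.

Lemma clique_space0 (x : clique_space 0) : x = 0.
Proof. by apply/malgP => p; have := clique_gt0 p. Qed.

Lemma clique_comp_linearl n m (i : 'I_n) (y : clique_space m) :
  linear (fun x : clique_space n => clique_comp i x y).
Proof. exact: linext_linear. Qed.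

Lemma clique_comp_linearr n m (i : 'I_n) (x : clique_space n) :
  linear (fun y : clique_space m => clique_comp i x y).
Proof.
move=> a y z; rewrite /clique_comp -linext_linearf; apply: eq_bigr => p _.
by rewrite linext_linear.
Qed.

Definition clique_cast n m (e : n = m) (x : clique_space n) : clique_space m :=
  ecast n (clique_space n) e x.

Lemma clique_cast_tagged n m (e : n = m) (x : clique_space n) (y : clique_space m) :
  clique_cast e x = y -> Tagged clique_space x = Tagged clique_space y.
Proof. by case: m / e y => y /= ->. Qed.

Lemma clique_cast_linear n m (e : n = m) : linear (clique_cast e).
Proof. by case: m / e. Qed.

Lemma clique_castU n m (e : n = m) (p : clique M n) (q : clique M m) :
  (forall x y, label p x y = label q x y) -> clique_cast e << p >> = << q >>.
Proof.
by case: m / e q => q eqpq /=; congr << _ >>; apply: label_inj => x y _ _.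
Qed.

Lemma linear_comp (U V W : lmodType K) (f : V -> W) (g : U -> V) :
  linear f -> linear g -> linear (fun x => f (g x)).
Proof. by move=> linf ling a x y; rewrite ling linf. Qed.

Lemma clique_comp1l n (i : 'I_1) (x : clique_space n) :
  Tagged clique_space (clique_comp i << unit_clique M >> x) = Tagged clique_space x.
Proof.
have e : (1 + n).-1 = n by lia.
apply: (clique_cast_tagged (e := e)); move: x; apply: linear_eq => //.
  exact: linear_comp (clique_cast_linear e) (clique_comp_linearr _ _).
by move=> p; rewrite clique_compU; apply: clique_castU => x y; exact: label_comp1l.
Qed.

Lemma clique_comp1r n (i : 'I_n) (x : clique_space n) :
  Tagged clique_space (clique_comp i x << unit_clique M >>) = Tagged clique_space x.
Proof.
have e : (n + 1).-1 = n by lia.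
apply: (clique_cast_tagged (e := e)); move: x; apply: linear_eq => //.
  exact: linear_comp (clique_cast_linear e) (clique_comp_linearl _ _).
by move=> p; rewrite clique_compU; apply: clique_castU => x y; exact: label_comp1r.
Qed.

Lemma clique_comp_seq n m l (i : 'I_n) (j : 'I_m) (k : 'I_(n + m).-1)
    (x : clique_space n) (y : clique_space m) (z : clique_space l) :
  k = (i + j)%N :> nat ->
  Tagged clique_space (clique_comp k (clique_comp i x y) z)
    = Tagged clique_space (clique_comp i x (clique_comp j y z)).
Proof.
move=> eqk.
have e : ((n + m).-1 + l).-1 = (n + (m + l).-1).-1.
  by have [lti ltj] := (ltn_ord i, ltn_ord j); lia.
apply: (clique_cast_tagged (e := e)).
move: x; apply: linear_eq => [||p].
- apply: linear_comp (clique_cast_linear e) _.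
  exact: linear_comp (clique_comp_linearl k z) (clique_comp_linearl i y).
- exact: clique_comp_linearl.
move: y; apply: linear_eq => [||q].
- apply: linear_comp (clique_cast_linear e) _.
  exact: linear_comp (clique_comp_linearl k z) (clique_comp_linearr i _).
- exact: linear_comp (clique_comp_linearr i _) (clique_comp_linearl j z).
move: z; apply: linear_eq => [||r].
- exact: linear_comp (clique_cast_linear e) (clique_comp_linearr k _).
- exact: linear_comp (clique_comp_linearr i _) (clique_comp_linearr j _).
by rewrite !clique_compU; apply: clique_castU => u v; exact: label_comp_seq.
Qed.

Lemma clique_comp_par n m l (i j : 'I_n)
    (j' : 'I_(n + m).-1) (i' : 'I_(n + l).-1)
    (x : clique_space n) (y : clique_space m) (z : clique_space l) :
  (i < j)%N -> j' = (j + m).-1%N :> nat -> i' = i :> nat ->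
  Tagged clique_space (clique_comp j' (clique_comp i x y) z)
    = Tagged clique_space (clique_comp i' (clique_comp j x z) y).
Proof.
move=> ltij eqj eqi.
have e : ((n + m).-1 + l).-1 = ((n + l).-1 + m).-1.
  by have := ltn_ord j; lia.
apply: (clique_cast_tagged (e := e)).
move: x; apply: linear_eq => [||p].
- apply: linear_comp (clique_cast_linear e) _.
  exact: linear_comp (clique_comp_linearl j' z) (clique_comp_linearl i y).
- exact: linear_comp (clique_comp_linearl i' y) (clique_comp_linearl j z).
move: y; apply: linear_eq => [||q].
- apply: linear_comp (clique_cast_linear e) _.
  exact: linear_comp (clique_comp_linearl j' z) (clique_comp_linearr i _).
- exact: clique_comp_linearr.
move: z; apply: linear_eq => [||r].
- exact: linear_comp (clique_cast_linear e) (clique_comp_linearr j' _).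
- exact: linear_comp (clique_comp_linearl i' _) (clique_comp_linearr j _).
by rewrite !clique_compU; apply: clique_castU => u v; exact: label_comp_par.
Qed.

Definition clique_operad : operad K :=
  {| op_space := clique_space;
     op_one := << unit_clique M >>;
     op_comp := clique_comp;
     op_space0 := clique_space0;
     op_comp_linearl := clique_comp_linearl;
     op_comp_linearr := clique_comp_linearr;
     op_comp1l := clique_comp1l;
     op_comp1r := clique_comp1r;
     op_comp_seq := clique_comp_seq;
     op_comp_par := clique_comp_par |}.

Definition clique_span (P : forall n, pred (clique M n)) n :
    clique_operad n -> Prop :=
  span (fun x : clique_operad n =>
    exists2 p : clique M n, P n p & x = << p >>).

End CliqueOperad.

(* Main.v *)
From mathcomp Require Import all_boot all_order all_algebra.
From mathcomp Require Import finmap zify monalg.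
Require Import Defs.

(** The vertices of [p o_i q] are those of [p], spread apart by the vertex map
    [outer_vertex i m], together with those of [q], shifted by [i]. The segment
    from [i] to [i + m], onto which the edge [i] of [p] and the base of [q] are
    glued, separates the arcs coming from [p] from those coming from [q]: no arc
    of one kind crosses an arc of the other kind, and the segment itself crosses
    no arc of either kind. Both vertex maps are increasing, so they preserve and
    reflect crossings. Hence every solid diagonal of [p] or [q] keeps its
    crossing inside [p o_i q]. The only other solid diagonal that may appear is
    the segment, which is crossed by nothing; the arcs of [p] and [q] it replaces
    are an edge and a base, which are not diagonals. This gives
      [cros (p o_i q) = max (cros p) (cros q)]           ([cros_comp]).
    A maximum is at least [k + 1] as soon as one of its terms is, and at most
    [k] when both terms are, so the cliques of large crossing absorb partial
    composition on both sides and those of small crossing are closed under it;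
    the unit clique, whose labels are all trivial, has crossing [0]. These
    closure properties pass to linear spans because composition is bilinear
    ([clique_span_comp]). *)

Set Implicit Arguments.
Unset Strict Implicit.
Unset Printing Implicit Defensive.

(** * Crossings and increasing vertex maps *)

(** Case analysis on the comparisons of numbers that the conditionals of the
    goal test. Innermost conditionals go first, so that a comparison of two
    [outer_vertex] images is split only when both images are known; impossible
    cases are discarded along the way. *)
Ltac split_ifs :=
  repeat match goal with
  | |- context [if ?b then _ else _] =>
    match b with
    | context [?u <= ?v] =>
      lazymatch constr:((u, v)) with
      | context [if _ then _ else _] => fail
      | _ => case: (leqP u v) => ? /=; try (exfalso; lia)
      end
    | context [@eq_op _ ?u ?v] =>
      lazymatch constr:((u, v)) with
      | context [if _ then _ else _] => fail
      | _ => case: (@eqP nat u v) => ? /=; try (exfalso; lia)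
      end
    end
  end.

Section SolidDiagonals.
Variable M : umagmaType.

(** Solid diagonals as pairs of natural numbers, so that arcs of cliques of
    different arities can be compared. *)
Definition solid_diagonal n (p : clique M n) x y :=
  [/\ x < y, y <= n, ~ (x = 0 /\ y = n), y <> x.+1 & label p x y != 1%g].

Lemma solid_diagonalP n (p : clique M n) (a : arc n) :
  reflect (solid_diagonal p (src a) (tgt a)) (diagonal a && solid p a).
Proof.
have lta : src a < tgt a := valP a.
have lea : tgt a <= n by rewrite -ltnS; exact: ltn_ord.
rewrite /diagonal /solid xpair_eqE -labelE.
apply: (iffP idP) => [/andP[/andP[Nbase Nedge] sol] | [_ _ Nbase Nedge ->]].
  by split=> //; lia.
by rewrite andbT; lia.
Qed.

Lemma crossing_setP n (p : clique M n) (a b : arc n) :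
  reflect (solid_diagonal p (src b) (tgt b) /\ crossing a b)
          (b \in [set c | [&& diagonal c, solid p c & crossing a c]]).
Proof.
by rewrite inE andbA; apply: (iffP andP) => -[/solid_diagonalP ? ?]; split.
Qed.

Lemma arc_eq n (a b : arc n) : src a = src b -> tgt a = tgt b -> a = b.
Proof.
case: a b => [[a1 a2] lta] [[b1 b2] ltb]; rewrite /src /tgt /= => e1 e2.
by apply: val_inj; congr pair; apply: val_inj.
Qed.

Lemma solid_diagonal_arc n (p : clique M n) x y : solid_diagonal p x y ->
  exists a : arc n, src a = x /\ tgt a = y.
Proof.
case=> ltxy leyn _ _ _; have ltyn : y < n.+1 by [].
pose z := (Ordinal (ltn_trans ltxy ltyn), Ordinal ltyn).
by exists (exist (fun xy : 'I_(_.+1) * 'I_(_.+1) => xy.1 < xy.2) z ltxy).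
Qed.

Section VertexMap.
Variables (n N : nat) (f : nat -> nat).
Hypotheses (f_mono : {mono f : x y / x < y}) (f_le : f n <= N).

Lemma vertex_map_ord (x : 'I_n.+1) : f x < N.+1.
Proof.
rewrite ltnS; apply: leq_trans f_le.
by rewrite leqNgt f_mono -leqNgt -ltnS.
Qed.

Lemma arc_map_lt (a : arc n) :
  Ordinal (vertex_map_ord (val a).1) < Ordinal (vertex_map_ord (val a).2).
Proof. by rewrite /= f_mono (valP a). Qed.

Definition arc_map (a : arc n) : arc N :=
  exist (fun xy : 'I_N.+1 * 'I_N.+1 => xy.1 < xy.2) (_, _) (arc_map_lt a).

Lemma src_arc_map a : src (arc_map a) = f (src a). Proof. by []. Qed.
Lemma tgt_arc_map a : tgt (arc_map a) = f (tgt a). Proof. by []. Qed.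

Lemma arc_map_inj : injective arc_map.
Proof.
have f_inj : injective f.
  by move=> x y eqxy; case: (ltngtP x y) => //; rewrite -f_mono eqxy ltnn.
by move=> a b eqab; apply: arc_eq; apply: f_inj;
  [have := congr1 (@src N) eqab | have := congr1 (@tgt N) eqab].
Qed.

Lemma crossing_arc_map a b : crossing (arc_map a) (arc_map b) = crossing a b.
Proof. by rewrite /crossing !src_arc_map !tgt_arc_map !f_mono. Qed.

Variables (p : clique M n) (P : clique M N).

(** Crossings are preserved by an increasing vertex map, so the solid diagonals
    crossing [a] are sent to distinct solid diagonals crossing its image. *)
Lemma crossing_number_arc_map_ge a :
  (forall x y, solid_diagonal p x y -> solid_diagonal P (f x) (f y)) ->
  crossing_number p a <= crossing_number P (arc_map a).
Proof.
move=> f_solid; rewrite /crossing_number -(card_imset _ arc_map_inj).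
apply/subset_leq_card/subsetP=> _ /imsetP[b /crossing_setP[pb ab] ->].
by apply/crossing_setP; split; [exact: f_solid | rewrite crossing_arc_map].
Qed.

(** Converse bound: only the solid diagonals of [P] that cross the image of [a]
    need to come from [p], as [P] has many other ones in a composition. *)
Lemma crossing_number_arc_map_le a :
  (forall B : arc N, solid_diagonal P (src B) (tgt B) ->
     crossing (arc_map a) B ->
     exists x y, [/\ solid_diagonal p x y, src B = f x & tgt B = f y]) ->
  crossing_number P (arc_map a) <= crossing_number p a.
Proof.
move=> f_onto; rewrite /crossing_number -(card_imset _ arc_map_inj).
apply/subset_leq_card/subsetP=> B /crossing_setP[PB aB].
have [x [y [pxy srcB tgtB]]] := f_onto B PB aB.
have [b [srcb tgtb]] := solid_diagonal_arc pxy.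
have defB : B = arc_map b.
  by apply: arc_eq; rewrite ?src_arc_map ?tgt_arc_map ?srcb ?tgtb.
rewrite {}defB in aB *; apply/imset_f/crossing_setP.
by rewrite srcb tgtb -crossing_arc_map.
Qed.

Lemma cros_vertex_map :
  (forall x y, solid_diagonal p x y -> solid_diagonal P (f x) (f y)) ->
  cros p <= cros P.
Proof.
move=> f_solid; apply/bigmax_leqP=> a /solid_diagonalP pa.
apply: leq_trans (crossing_number_arc_map_ge a f_solid) _.
by apply: leq_bigmax_cond; apply/solid_diagonalP; exact: f_solid.
Qed.

End VertexMap.

Lemma crossing_number_le_cros n (p : clique M n) (a : arc n) :
  solid_diagonal p (src a) (tgt a) -> crossing_number p a <= cros p.
Proof. by move=> /solid_diagonalP pa; exact: leq_bigmax_cond. Qed.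

(** * The crossing of a composition *)

Definition outer_vertex i m x := if x <= i then x else x + m.-1.

Lemma outer_vertex_mono i m : {mono outer_vertex i m : x y / x < y}.
Proof. by move=> x y; rewrite /outer_vertex; split_ifs; lia. Qed.

Section Composition.
Variables (n m : nat) (p : clique M n) (i : 'I_n) (q : clique M m).

Lemma outer_vertex_le : outer_vertex i m n <= (n + m).-1.
Proof.
have [lti gtm] := (ltn_ord i, clique_gt0 q).
by rewrite /outer_vertex; split_ifs; lia.
Qed.

Lemma inner_vertex_le : i + m <= (n + m).-1.
Proof. by have := ltn_ord i; lia. Qed.

(** The edge [i] of [p] is excluded because its image is the glued segment,
    whose label involves the base of [q]. *)
Lemma comp_label_outer x y : x < y -> ~ (x = i /\ y = i.+1) ->
  comp_label p i q (outer_vertex i m x) (outer_vertex i m y) = label p x y.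
Proof.
have gtm := clique_gt0 q; rewrite /comp_label /outer_vertex !xpair_eqE.
move: (nat_of_ord i) (label p) (label q) => j P Q ltxy Nedge.
by split_ifs; first [by [] | congr (P _ _); lia].
Qed.

Lemma comp_label_inner x y : x < y -> y <= m -> ~ (x = 0 /\ y = m) ->
  comp_label p i q (i + x) (i + y) = label q x y.
Proof.
rewrite /comp_label !xpair_eqE.
move: (nat_of_ord i) (label p) (label q) => j P Q ltxy leym Nbase.
by split_ifs; congr (Q _ _); lia.
Qed.

(** The labels of [p o_i q] which are copied neither from [p] nor from [q] nor
    carried by the glued segment are those of the arcs with one end strictly
    between [i] and [i + m] and the other outside, and they are trivial. *)
Lemma comp_label_neq1 x y : x < y -> comp_label p i q x y != 1%g ->
  [\/ exists u v, [/\ u < v, ~ (u = i /\ v = i.+1), x = outer_vertex i m u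
                    & y = outer_vertex i m v],
      exists u v, [/\ u < v, v <= m, ~ (u = 0 /\ v = m), x = i + u & y = i + v]
    | x = i /\ y = i + m].
Proof.
have gtm := clique_gt0 q; rewrite /comp_label /outer_vertex !xpair_eqE.
move: (nat_of_ord i) (label p) (label q) => j P Q ltxy; split_ifs; move=> neq1.
all: try by rewrite eqxx in neq1.
all: try by constructor 3; lia.
all: try by constructor 2; exists (x - j), (y - j); split; lia.
(* The inverse of [outer_vertex i m]. *)
all: constructor 1; exists (if x <= j then x else x - m.-1).
all: exists (if y <= j then y else y - m.-1).
all: by split_ifs; split; lia.
Qed.

Lemma solid_diagonal_outer x y : solid_diagonal p x y ->
  solid_diagonal (comp_clique p i q) (outer_vertex i m x) (outer_vertex i m y).
Proof.
have [lti gtm] := (ltn_ord i, clique_gt0 q).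
case=> ltxy leyn Nbase Nedge; have Nglue : ~ (x = i /\ y = i.+1) by lia.
have [ltxy' leyn'] : outer_vertex i m x < outer_vertex i m y
    /\ outer_vertex i m y <= (n + m).-1.
  by rewrite outer_vertex_mono /outer_vertex; split_ifs; lia.
rewrite -(comp_label_outer ltxy Nglue) => sol; split=> //.
- by rewrite /outer_vertex; split_ifs; lia.
- by rewrite /outer_vertex; split_ifs; lia.
- by rewrite label_comp ltxy' leyn'.
Qed.

Lemma solid_diagonal_inner x y : solid_diagonal q x y ->
  solid_diagonal (comp_clique p i q) (i + x) (i + y).
Proof.
have lti := ltn_ord i; case=> ltxy leym Nbase Nedge.
rewrite -(comp_label_inner ltxy leym Nbase) => sol; split; try lia.
by rewrite label_comp !ifT //; lia.
Qed.

Lemma solid_diagonal_comp x y : solid_diagonal (comp_clique p i q) x y ->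
  [\/ exists u v, [/\ solid_diagonal p u v, x = outer_vertex i m u
                    & y = outer_vertex i m v],
      exists u v, [/\ solid_diagonal q u v, x = i + u & y = i + v]
    | x = i /\ y = i + m].
Proof.
have [lti gtm] := (ltn_ord i, clique_gt0 q).
case=> ltxy leyn Nbase Nedge; rewrite label_comp ltxy leyn => sol.
case: (comp_label_neq1 ltxy sol) => [[u [v [ltuv Nglue ex ey]]]
                                    |[u [v [ltuv levm Nb ex ey]]]|glue].
- constructor 1; exists u, v; split=> //; split=> //.
  + by move: leyn; rewrite ey /outer_vertex; split_ifs; lia.
  + by move: Nbase; rewrite ex ey /outer_vertex; split_ifs; lia.
  + by move: Nedge; rewrite ex ey /outer_vertex; split_ifs; lia.
  + by rewrite -(comp_label_outer ltuv Nglue) -ex -ey.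
- constructor 2; exists u, v; split=> //; split=> //; first by lia.
  by rewrite -(comp_label_inner ltuv levm Nb) -ex -ey.
- by constructor 3.
Qed.

(** No vertex of [p] lies strictly between [i] and [i + m], whereas the arcs of
    [q] stay within this range: crossing would need an end point of the first
    arc strictly between those of the second one. *)
Lemma crossing_outer_inner (a b : arc (n + m).-1) u v u' v' : v' <= m ->
  src a = outer_vertex i m u -> tgt a = outer_vertex i m v ->
  src b = i + u' -> tgt b = i + v' -> crossing a b = false.
Proof.
have gtm := clique_gt0 q; rewrite /crossing /outer_vertex => lev' -> -> -> ->.
by split_ifs; lia.
Qed.

Lemma crossing_sym N (a b : arc N) : crossing a b = crossing b a.
Proof. by rewrite /crossing orbC. Qed.

Lemma crossing_glued_outer (a b : arc (n + m).-1) u v :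
  src a = i -> tgt a = i + m ->
  src b = outer_vertex i m u -> tgt b = outer_vertex i m v ->
  crossing a b = false.
Proof.
have gtm := clique_gt0 q; rewrite /crossing /outer_vertex => -> -> -> ->.
by split_ifs; lia.
Qed.

Lemma crossing_glued_inner (a b : arc (n + m).-1) u v : v <= m ->
  src a = i -> tgt a = i + m -> src b = i + u -> tgt b = i + v ->
  crossing a b = false.
Proof. by rewrite /crossing => lev -> -> -> ->; lia. Qed.

Lemma crossing_same_ends N (a b : arc N) :
  src a = src b -> tgt a = tgt b -> crossing a b = false.
Proof. by rewrite /crossing => -> ->; lia. Qed.

Lemma inner_vertex_mono : {mono addn i : x y / x < y}.
Proof. by move=> x y; rewrite ltn_add2l. Qed.

(** When the glued segment is a solid diagonal, no solid diagonal crosses it, so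
    that it adds nothing to the maximum; every other solid diagonal keeps the
    crossing it has in [p] or in [q]. *)
Theorem cros_comp : cros (comp_clique p i q) = maxn (cros p) (cros q).
Proof.
apply/eqP; rewrite eqn_leq geq_max; apply/andP; split; last first.
  rewrite (cros_vertex_map (outer_vertex_mono i m) outer_vertex_le solid_diagonal_outer).
  exact: (cros_vertex_map inner_vertex_mono inner_vertex_le solid_diagonal_inner).
apply/bigmax_leqP=> A /solid_diagonalP PA; rewrite leq_max.
case: (solid_diagonal_comp PA) => [[u [v [puv sA tA]]]|[u [v [quv sA tA]]]|[sA tA]].
- apply/orP; left; have [a [sa ta]] := solid_diagonal_arc puv.
  have defA : A = arc_map (outer_vertex_mono i m) outer_vertex_le a.
    by apply: arc_eq; rewrite ?src_arc_map ?tgt_arc_map ?sa ?ta.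
  have pa : solid_diagonal p (src a) (tgt a) by rewrite sa ta.
  apply: leq_trans (crossing_number_le_cros pa); rewrite defA.
  apply: crossing_number_arc_map_le => B PB; rewrite -defA => AB.
  case: (solid_diagonal_comp PB) => [[u' [v' [? ? ?]]]|[u' [v' [[_ lev' _ _ _] sB tB]]]|[sB tB]].
  + by exists u', v'.
  + by rewrite (crossing_outer_inner lev' sA tA sB tB) in AB.
  + by rewrite crossing_sym (crossing_glued_outer sB tB sA tA) in AB.
- apply/orP; right; have [a [sa ta]] := solid_diagonal_arc quv.
  have lev : v <= m by case: quv.
  have defA : A = arc_map inner_vertex_mono inner_vertex_le a.
    by apply: arc_eq; rewrite ?src_arc_map ?tgt_arc_map ?sa ?ta.
  have qa : solid_diagonal q (src a) (tgt a) by rewrite sa ta.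
  apply: leq_trans (crossing_number_le_cros qa); rewrite defA.
  apply: crossing_number_arc_map_le => B PB; rewrite -defA => AB.
  case: (solid_diagonal_comp PB) => [[u' [v' [_ sB tB]]]|[u' [v' [? ? ?]]]|[sB tB]].
  + by rewrite crossing_sym (crossing_outer_inner lev sB tB sA tA) in AB.
  + by exists u', v'.
  + by rewrite crossing_sym (crossing_glued_inner lev sB tB sA tA) in AB.
- rewrite /crossing_number (_ : [set _ | _] = set0) ?cards0 //.
  apply/setP=> B; rewrite [RHS]inE; apply/negP=> /crossing_setP[PB].
  case: (solid_diagonal_comp PB) => [[u [v [_ sB tB]]]|[u [v [[_ lev _ _ _] sB tB]]]|[sB tB]].
  + by rewrite (crossing_glued_outer sA tA sB tB).
  + by rewrite (crossing_glued_inner lev sA tA sB tB).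
  + by rewrite crossing_same_ends ?sA ?tA ?sB ?tB.
Qed.

End Composition.

Lemma cros_unit : cros (unit_clique M) = 0.
Proof. by rewrite /cros big_pred0 // => a; rewrite /solid ffunE eqxx andbF. Qed.

End SolidDiagonals.

(** * Linear spans of cliques *)

Section Spans.
Variable K : fieldType.
Import GRing.Theory.
Local Open Scope ring_scope.

Lemma subspace_span (V : lmodType K) (S : V -> Prop) : subspace (span S).
Proof.
split=> [|a u v [s [Ss ->]] [t [St ->]]]; first by exists [::]; rewrite big_nil.
exists ([seq (a * c.1, c.2) | c <- s] ++ t); split=> [c|].
  by rewrite mem_cat => /orP[/mapP[d /Ss Sd ->]|/St].
rewrite big_cat big_map scaler_sumr; congr (_ + _).
by apply: eq_bigr => c _; rewrite scalerA.
Qed.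

Lemma mem_span (V : lmodType K) (S : V -> Prop) v : S v -> span S v.
Proof.
move=> Sv; exists [:: (1, v)]; rewrite big_seq1 scale1r; split=> // c.
by rewrite inE => /eqP->.
Qed.

Lemma span_min (V : lmodType K) (S T : V -> Prop) :
  subspace T -> (forall v, S v -> T v) -> forall v, span S v -> T v.
Proof.
move=> [T0 Tlin] ST _ [s [Ss ->]]; elim: s Ss => [|c s IHs] Ss.
  by rewrite big_nil.
rewrite big_cons; apply: Tlin; first by apply/ST/Ss/mem_head.
by apply: IHs => d sd; apply: Ss; rewrite inE sd orbT.
Qed.

Lemma subspace_preim (U V : lmodType K) (f : U -> V) (T : V -> Prop) :
  linear f -> subspace T -> subspace (fun u => T (f u)).
Proof.
move=> flin [T0 Tlin]; split=> [|a u v Tu Tv]; last by rewrite flin; apply: Tlin.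
suff -> : f 0 = 0 by [].
by have := flin (-1) 0 0; rewrite scaler0 addr0 scaleN1r addNr.
Qed.

Lemma malg_sum_mcoeff (T : choiceType) (x : {malg K[T]}) :
  x = \sum_(t <- msupp x) x@_t *: << t >>.
Proof.
rewrite [LHS]monalgE; apply: eq_bigr => t _.
by apply/malgP => u; rewrite mcoeffZ !mcoeffU mulrnAr mulr1.
Qed.

Variable M : umagmaType.

(** Bilinearity reduces a closure property of spans to cliques: fix [y] and let
    [x] run over the span, then fix a clique [p] and let [y] run. *)
Lemma clique_span_comp (P Q R : forall n, pred (clique M n)) n m (i : 'I_n)
    (x : clique_operad K M n) (y : clique_operad K M m) :
  (forall p q, P n p -> Q m q -> R (n + m).-1%N (comp_clique p i q)) ->
  clique_span P x -> clique_span Q y -> clique_span R (op_comp i x y).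
Proof.
move=> PQR Px Qy; move: x Px; apply: span_min.
  by apply: subspace_preim (subspace_span _); apply: op_comp_linearl.
move=> _ [p Pp ->]; move: y Qy; apply: span_min.
  by apply: subspace_preim (subspace_span _); apply: op_comp_linearr.
move=> _ [q Qq ->]; rewrite [op_comp _ _ _]clique_compU; apply: mem_span.
by exists (comp_clique p i q) => //; apply: PQR.
Qed.

Lemma clique_span_full n (x : clique_operad K M n) :
  clique_span (fun n => predT : pred (clique M n)) x.
Proof.
exists [seq (x@_p, << p >>) | p <- msupp x]; split=> [_ /mapP[p _ ->]|].
  by exists p.
by rewrite big_map; exact: malg_sum_mcoeff.
Qed.

End Spans.

(** * Ideal and suboperad *)

Theorem proposition3p1p3 (K : fieldType) (charK : [pchar K]%R =i pred0)
    (M : umagmaType) (k : nat) :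
  @operad_ideal K (clique_operad K M)
    (@clique_span K M (fun n (p : clique M n) => k.+1 <= cros p)) /\
  @suboperad K (clique_operad K M)
    (@clique_span K M (fun n (p : clique M n) => cros p <= k)).
Proof.
split.
  split=> [n|n m x y Iy]; first exact: subspace_span.
  split=> [i|j].
    (* [x] is arbitrary: it lies in the span of all cliques. *)
    apply: clique_span_comp (clique_span_full x) Iy => p q _ le_q.
    by rewrite cros_comp leq_max le_q orbT.
  apply: clique_span_comp Iy (clique_span_full x) => q p le_q _.
  by rewrite cros_comp leq_max le_q.
split=> [n||n m i x y]; first exact: subspace_span.
  by apply: mem_span; exists (unit_clique M); rewrite ?cros_unit.
by apply: clique_span_comp => p q le_p le_q; rewrite cros_comp geq_max le_p.
Qed.
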